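(* Let $\Sigma$ be a terminating $2$-polygraph that presents a category $\mathbf{C}$, equipped with a total termination order. Then the homotopical completion $\mathcal{S}(\Sigma)$ of $\Sigma$ is a coherent convergent presentation of $\mathbf{C}$.
   Context: **Polygraphs and coherent presentations.** All $n$-categories are strict and globular; $f\star_i g$ is composition along $i$-cells in diagrammatic order. A $2$-polygraph consists of a set $\Sigma_0$ of $0$-cells, a set $\Sigma_1$ of generating $1$-cells with source and target in $\Sigma_0$ (generating the free category $\Sigma_1^*$), and a set $\Sigma_2$ of generating $2$-cells, each with source and target a pair of parallel $1$-cells of $\Sigma_1^*$. $\Sigma_2^*$ is the free $2$-category and $\Sigma_2^\top$ the free $(2,1)$-category it generates. The category presented is the quotient of $\Sigma_1^*$ by the congruence generated by $\Sigma_2$. A $(3,1)$-polygraph is a $2$-polygraph together with a set $\Sigma_3$ of generating $3$-cells, each with source and target a pair of parallel $2$-cells of $\Sigma_2^\top$; the category it presents is the one presented by its underlying $2$-polygraph. It is a coherent presentation of $\mathbf{C}$ if the category it presents is isomorphic to $\mathbf{C}$ and $\Sigma_3$ is a homotopy basis, i.e. any two parallel $2$-cells of $\Sigma_2^\top$ become equal in the quotient $\Sigma_2^\top/\Sigma_3$. **Rewriting.** A rewriting step of a $2$-polygraph $\Sigma$ is a $2$-cell $w\alpha w'$ of $\Sigma_2^*$ with $\alpha\in\Sigma_2$ and $w,w'$ $1$-cells of $\Sigma_1^*$. A normal form is a $1$-cell that is the source of no rewriting step. $\Sigma$ terminates if there is no infinite sequence of composable rewriting steps. A termination order is a well-founded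 order on $1$-cells, compatible with composition, with $s(f)>t(f)$ for every rewriting step $f$; it is total if it compares any two parallel $1$-cells. A branching is an unordered pair $(f,g)$ of $2$-cells of $\Sigma_2^*$ with a common source; it is confluent if there are $2$-cells $f',g'$ of $\Sigma_2^*$ with a common target such that $f\star_1f'$ and $g\star_1g'$ are defined. $\Sigma$ is confluent if all its branchings are, and convergent if it terminates and is confluent. A $(3,1)$-polygraph is convergent if its underlying $2$-polygraph is. A branching is local if $f,g$ are rewriting steps. A local branching is aspherical if $f=g$, Peiffer if it has the form $(fv,ug)$ with $u=s(f)$, $v=s(g)$, and overlap otherwise. Critical branchings are the overlap local branchings that are minimal for the order given by inclusion of sources (i.e. under $(f,g)\le(ufv,ugv)$). **Homotopical completion.** Given a terminating $2$-polygraph $\Sigma$ with a total termination order $\le$, define an increasing sequence of $(3,1)$-polygraphs $\Sigma^0\subseteq\Sigma^1\subseteq\cdots$ with $\Sigma^0=(\Sigma,\emptyset)$; $\Sigma^{n+1}$ is obtained from $\Sigma^n$ by treating each (not yet treated) critical branching $(f:u\Rightarrow v,\ g:u\Rightarrow w)$ of $\Sigma^n$ as follows. If it is confluent, choose $f',g'$ with a common target such that $f\star_1f'$ and $g\star_1g'$ are parallel, and add a $3$-cell $\gamma:f\star_1f'\Rrightarrow g\star_1g'$. If it is not confluent, choose $2$-cells $f':v\Rightarrow\hat v$ and $g':w\Rightarrow\hat w$ of the free $2$-category to normal forms $\hat v\neq\hat w$, and add a $2$-cell $\alpha$ between $\hat v$ and $\hat w$, directed from the greater to the smaller for $\le$,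 together with a $3$-cell $\gamma$ filling the resulting diagram (i.e. $\gamma:f\star_1f'\star_1\alpha\Rrightarrow g\star_1g'$ if $\alpha:\hat v\Rightarrow\hat w$, and $\gamma:f\star_1f'\Rrightarrow g\star_1g'\star_1\alpha$ if $\alpha:\hat w\Rightarrow\hat v$). $\mathcal{S}(\Sigma)$ is the (possibly infinite) union of the $\Sigma^n$. *)

(* Defs.v *)
From Stdlib Require Import FunctionalExtensionality PropExtensionality ProofIrrelevance.

Set Implicit Arguments.
Unset Strict Implicit.

(** * Categories *)

(** Composition is written in diagrammatic order throughout. *)
Record category : Type := Category {
  obj :> Type;
  hom : obj -> obj -> Type;
  idm : forall x, hom x x;
  compm : forall x y z, hom x y -> hom y z -> hom x z;
  compm1l : forall x y (f : hom x y), compm (idm x) f = f;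
  compm1r : forall x y (f : hom x y), compm f (idm y) = f;
  compmA : forall x y z t (f : hom x y) (g : hom y z) (h : hom z t),
    compm f (compm g h) = compm (compm f g) h
}.

Record functor (C D : category) : Type := Functor {
  fobj :> C -> D;
  fmor : forall x y, hom x y -> hom (fobj x) (fobj y);
  fmor1 : forall x, fmor (idm x) = idm (fobj x);
  fmorM : forall x y z (f : hom x y) (g : hom y z),
    fmor (compm f g) = compm (fmor f) (fmor g)
}.

Definition functor_id (C : category) : functor C C :=
  @Functor C C (fun x => x) (fun x y f => f)
    (fun x => eq_refl) (fun x y z f g => eq_refl).

Definition functor_comp (C D E : category)
    (F : functor C D) (H : functor D E) : functor C E.
Proof.
  refine (@Functor C E (fun x => H (F x)) (fun x y f => fmor H (fmor F f)) _ _).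
  - intros x. rewrite fmor1. apply fmor1.
  - intros x y z f g. rewrite fmorM. apply fmorM.
Defined.

Definition isomorphic (C D : category) : Prop :=
  exists (F : functor C D) (H : functor D C),
    functor_comp F H = functor_id C /\ functor_comp H F = functor_id D.

(** * Free categories and their quotients *)

Record graph : Type := Graph {
  vertex :> Type;
  edge : vertex -> vertex -> Type
}.

Section FreeCategory.
Variable G : graph.

Inductive path : G -> G -> Type :=
| path_nil : forall x, path x x
| path_cons : forall x y z, edge x y -> path y z -> path x z.

Fixpoint cat {x y : G} (u : path x y) : forall z : G, path y z -> path x z :=
  match u in path x y return forall z : G, path y z -> path x z with
  | path_nil x => fun z v => v
  | path_cons a u' => fun z v => path_cons a (cat u' v)
  end.

Lemma cat_nil_r x y (u : path x y) : cat u (path_nil y) = u.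
Proof.
  induction u as [|x y z a u IH]; simpl; [reflexivity | now rewrite IH].
Qed.

Lemma cat_assoc x y z t (u : path x y) (v : path y z) (w : path z t) :
  cat u (cat v w) = cat (cat u v) w.
Proof.
  revert z t v w; induction u as [|x y z' a u IH]; intros; simpl;
    [reflexivity | now rewrite IH].
Qed.

Record congruence : Type := Congruence {
  crel : forall x y, path x y -> path x y -> Prop;
  crel_refl : forall x y (u : path x y), crel u u;
  crel_sym : forall x y (u v : path x y), crel u v -> crel v u;
  crel_trans : forall x y (u v w : path x y),
    crel u v -> crel v w -> crel u w;
  crel_cat : forall x y z (u u' : path x y) (v v' : path y z),
    crel u u' -> crel v v' -> crel (cat u v) (cat u' v')
}.

Section Quotient.
Variable E : congruence.

(** A morphism of the quotient is an equivalence class of paths. *)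
Definition class_hom (x y : G) : Type :=
  {S : path x y -> Prop | exists u, S = @crel E x y u}.

Definition class (x y : G) (u : path x y) : class_hom x y :=
  exist _ (@crel E x y u) (ex_intro _ u eq_refl).

Definition class_mul_set (x y z : G)
    (S : path x y -> Prop) (T : path y z -> Prop) (w : path x z) : Prop :=
  exists u v, S u /\ T v /\ crel E (cat u v) w.

Lemma class_mul_setE x y z (u : path x y) (v : path y z) :
  class_mul_set (@crel E x y u) (@crel E y z v) = @crel E x z (cat u v).
Proof.
  apply functional_extensionality; intros w.
  apply propositional_extensionality; split.
  - intros (u' & v' & Hu & Hv & Hw).
    apply crel_trans with (cat u' v'); [now apply crel_cat | exact Hw].
  - intros Hw; exists u, v; repeat split; try apply crel_refl; exact Hw.
Qed.

Lemma class_mul_subproof x y z (S : class_hom x y) (T : class_hom y z) :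
  exists w, class_mul_set (proj1_sig S) (proj1_sig T) = @crel E x z w.
Proof.
  destruct S as [S [u ->]], T as [T [v ->]]; simpl.
  exists (cat u v); apply class_mul_setE.
Qed.

Definition class_mul (x y z : G) (S : class_hom x y) (T : class_hom y z) :
    class_hom x z :=
  exist _ (class_mul_set (proj1_sig S) (proj1_sig T)) (class_mul_subproof S T).

Lemma class_hom_eq x y (S T : class_hom x y) :
  proj1_sig S = proj1_sig T -> S = T.
Proof.
  destruct S as [S HS], T as [T HT]; simpl; intros ->.
  f_equal; apply proof_irrelevance.
Qed.

Lemma class_mulE x y z (u : path x y) (v : path y z) :
  class_mul (class u) (class v) = class (cat u v).
Proof. apply class_hom_eq, class_mul_setE. Qed.

Lemma classP x y (S : class_hom x y) : exists u, S = class u.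
Proof. destruct S as [S [u ->]]; exists u; now apply class_hom_eq. Qed.

Definition quotient_category : category.
Proof.
  refine (@Category G class_hom (fun x => class (path_nil x)) class_mul _ _ _).
  - intros x y f; destruct (classP f) as [u ->]; now rewrite class_mulE.
  - intros x y f; destruct (classP f) as [u ->].
    now rewrite class_mulE, cat_nil_r.
  - intros x y z t f g h; destruct (classP f) as [u ->].
    destruct (classP g) as [v ->]; destruct (classP h) as [w ->].
    now rewrite !class_mulE, cat_assoc.
Defined.

End Quotient.
End FreeCategory.

(** * 2-polygraphs *)

(** A 2-polygraph whose 0-cells and generating 1-cells form the graph [G]:
    [Sigma x y u v] is the set of generating 2-cells with source [u] and
    target [v]. *)
Definition polygraph2 (G : graph) : Type :=
  forall x y : G, path x y -> path x y -> Type.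

Section Presentation.
Variables (G : graph) (Sigma : polygraph2 G).

Inductive congruent : forall x y : G, path x y -> path x y -> Prop :=
| congruent_gen : forall x y (u v : path x y), Sigma u v -> congruent u v
| congruent_refl : forall x y (u : path x y), congruent u u
| congruent_sym : forall x y (u v : path x y), congruent u v -> congruent v u
| congruent_trans : forall x y (u v w : path x y),
    congruent u v -> congruent v w -> congruent u w
| congruent_cat : forall x y z (u u' : path x y) (v v' : path y z),
    congruent u u' -> congruent v v' -> congruent (cat u v) (cat u' v').

Definition generated_congruence : congruence G :=
  Congruence congruent_refl congruent_sym congruent_trans congruent_cat.

Definition presented_category : category :=
  quotient_category generated_congruence.

Definition presents (C : category) : Prop := isomorphic presented_category C.

End Presentation.

(** * The free 2-category on a 2-polygraph *)

Section FreeTwoCategory.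
Variables (G : graph) (Sigma : polygraph2 G).

(** The 2-cells of the free 2-category are these expressions modulo [eq2]. *)
Inductive cell2 : forall x y : G, path x y -> path x y -> Type :=
| gen2 : forall x y (u v : path x y), Sigma u v -> cell2 u v
| id2 : forall x y (u : path x y), cell2 u u
| comp1 : forall x y (u v w : path x y), cell2 u v -> cell2 v w -> cell2 u w
| comp0 : forall x y z (u v : path x y) (u' v' : path y z),
    cell2 u v -> cell2 u' v' -> cell2 (cat u u') (cat v v').

Local Infix "⋆1" := comp1 (at level 41, left associativity).
Local Infix "⋆0" := comp0 (at level 40, left associativity).

(** The congruence generated by the axioms of strict 2-categories.  It is
    heterogeneous because concatenation of paths is associative and unital
    only up to propositional equality; it only relates cells whose sources
    are equal and whose targets are equal. *)
Inductive eq2 : forall (x y : G) (u v u' v' : path x y),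
    cell2 u v -> cell2 u' v' -> Prop :=
| eq2_refl : forall x y (u v : path x y) (f : cell2 u v), eq2 f f
| eq2_sym : forall x y (u v u' v' : path x y)
    (f : cell2 u v) (f' : cell2 u' v'), eq2 f f' -> eq2 f' f
| eq2_trans : forall x y (u v u' v' u'' v'' : path x y)
    (f : cell2 u v) (f' : cell2 u' v') (f'' : cell2 u'' v''),
    eq2 f f' -> eq2 f' f'' -> eq2 f f''
| eq2_comp1 : forall x y (u v w u' v' w' : path x y)
    (f : cell2 u v) (g : cell2 v w) (f' : cell2 u' v') (g' : cell2 v' w'),
    eq2 f f' -> eq2 g g' -> eq2 (f ⋆1 g) (f' ⋆1 g')
| eq2_comp0 : forall x y z (u v u' v' : path x y) (s t s' t' : path y z)
    (f : cell2 u v) (g : cell2 s t) (f' : cell2 u' v') (g' : cell2 s' t'),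
    eq2 f f' -> eq2 g g' -> eq2 (f ⋆0 g) (f' ⋆0 g')
| eq2_comp1_1l : forall x y (u v : path x y) (f : cell2 u v),
    eq2 (id2 u ⋆1 f) f
| eq2_comp1_1r : forall x y (u v : path x y) (f : cell2 u v),
    eq2 (f ⋆1 id2 v) f
| eq2_comp1A : forall x y (u v w s : path x y)
    (f : cell2 u v) (g : cell2 v w) (h : cell2 w s),
    eq2 (f ⋆1 (g ⋆1 h)) ((f ⋆1 g) ⋆1 h)
| eq2_comp0_1l : forall x y (u v : path x y) (f : cell2 u v),
    eq2 (id2 (path_nil x) ⋆0 f) f
| eq2_comp0_1r : forall x y (u v : path x y) (f : cell2 u v),
    eq2 (f ⋆0 id2 (path_nil y)) f
| eq2_comp0A : forall x y z t (u v : path x y) (u' v' : path y z)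
    (u'' v'' : path z t)
    (f : cell2 u v) (g : cell2 u' v') (h : cell2 u'' v''),
    eq2 (f ⋆0 (g ⋆0 h)) ((f ⋆0 g) ⋆0 h)
| eq2_comp0_id : forall x y z (u : path x y) (v : path y z),
    eq2 (id2 u ⋆0 id2 v) (id2 (cat u v))
| eq2_exchange : forall x y z (u v w : path x y) (u' v' w' : path y z)
    (f : cell2 u v) (g : cell2 v w) (f' : cell2 u' v') (g' : cell2 v' w'),
    eq2 ((f ⋆1 g) ⋆0 (f' ⋆1 g')) ((f ⋆0 f') ⋆1 (g ⋆0 g')).

Definition whisker (x' x y y' : G) (w : path x' x) (u v : path x y)
    (f : cell2 u v) (w' : path y y') :
    cell2 (cat (cat w u) w') (cat (cat w v) w') :=
  id2 w ⋆0 f ⋆0 id2 w'.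

(** * Rewriting *)

Definition rewriting_step (x y : G) (u v : path x y) (f : cell2 u v) : Prop :=
  exists (x' y' : G) (w : path x x') (s t : path x' y') (a : Sigma s t)
    (w' : path y' y), eq2 f (whisker w (gen2 a) w').

Definition normal_form (x y : G) (u : path x y) : Prop :=
  ~ exists (v : path x y) (f : cell2 u v), rewriting_step f.

Definition terminating : Prop :=
  ~ exists (x y : G) (u : nat -> path x y)
      (f : forall n, cell2 (u n) (u (S n))), forall n, rewriting_step (f n).

(** Branchings are recorded as ordered pairs; [same_branching] is their
    equality as unordered pairs of 2-cells. *)
Record branching (x y : G) : Type := Branching {
  bsrc : path x y;
  bltgt : path x y;
  brtgt : path x y;
  bleft : cell2 bsrc bltgt;
  bright : cell2 bsrc brtgt
}.

Definition same_branching (x y : G) (b c : branching x y) : Prop :=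
  (eq2 (bleft b) (bleft c) /\ eq2 (bright b) (bright c)) \/
  (eq2 (bleft b) (bright c) /\ eq2 (bright b) (bleft c)).

Definition confluent_branching (x y : G) (b : branching x y) : Prop :=
  exists (t : path x y) (f' : cell2 (bltgt b) t) (g' : cell2 (brtgt b) t), True.

Definition confluent : Prop :=
  forall (x y : G) (b : branching x y), confluent_branching b.

Definition convergent : Prop := terminating /\ confluent.

Definition local_branching (x y : G) (b : branching x y) : Prop :=
  rewriting_step (bleft b) /\ rewriting_step (bright b).

Definition aspherical (x y : G) (b : branching x y) : Prop :=
  eq2 (bleft b) (bright b).

Definition peiffer (x z : G) (b : branching x z) : Prop :=
  exists (y : G) (u u' : path x y) (v v' : path y z)
    (f : cell2 u u') (g : cell2 v v'),
    rewriting_step f /\ rewriting_step g /\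
    same_branching b (Branching (f ⋆0 id2 v) (id2 u ⋆0 g)).

Definition overlap (x y : G) (b : branching x y) : Prop :=
  local_branching b /\ ~ aspherical b /\ ~ peiffer b.

Definition whisker_branching (x' x y y' : G) (w : path x' x)
    (b : branching x y) (w' : path y y') : branching x' y' :=
  Branching (whisker w (bleft b) w') (whisker w (bright b) w').

Definition branching_le (x y x' y' : G)
    (b : branching x y) (c : branching x' y') : Prop :=
  exists (w : path x' x) (w' : path y y'),
    same_branching (whisker_branching w b w') c.

Definition critical (x y : G) (b : branching x y) : Prop :=
  overlap b /\
  forall (x' y' : G) (c : branching x' y'),
    overlap c -> branching_le c b -> branching_le b c.

End FreeTwoCategory.

Arguments gen2 {G Sigma x y u v} _.
Arguments id2 {G Sigma x y} u.

Section Orders.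
Variable G : graph.

Definition path_relation : Type := forall x y : G, path x y -> path x y -> Prop.

Definition strict (le : path_relation) : path_relation :=
  fun x y u v => le x y u v /\ u <> v.

Record termination_order (Sigma : polygraph2 G) (le : path_relation) : Prop :=
  TerminationOrder {
  le_refl : forall x y (u : path x y), le x y u u;
  le_antisym : forall x y (u v : path x y), le x y u v -> le x y v u -> u = v;
  le_trans : forall x y (u v w : path x y),
    le x y u v -> le x y v w -> le x y u w;
  lt_wf : forall x y : G, well_founded (@strict le x y);
  le_cat : forall x y z (u u' : path x y) (v v' : path y z),
    le x y u u' -> le y z v v' -> le x z (cat u v) (cat u' v');
  lt_step : forall x y (u v : path x y) (f : cell2 Sigma u v),
    rewriting_step f -> strict le v u
}.

Definition total_order (le : path_relation) : Prop :=
  forall x y (u v : path x y), le x y u v \/ le x y v u.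

End Orders.

(** * Free (2,1)-categories and (3,1)-polygraphs *)

Section FreeTwoOneCategory.
Variables (G : graph) (Sigma : polygraph2 G).

Inductive cell21 : forall x y : G, path x y -> path x y -> Type :=
| gen21 : forall x y (u v : path x y), Sigma u v -> cell21 u v
| id21 : forall x y (u : path x y), cell21 u u
| inv21 : forall x y (u v : path x y), cell21 u v -> cell21 v u
| comp1_21 : forall x y (u v w : path x y),
    cell21 u v -> cell21 v w -> cell21 u w
| comp0_21 : forall x y z (u v : path x y) (u' v' : path y z),
    cell21 u v -> cell21 u' v' -> cell21 (cat u u') (cat v v').

Local Infix "⋆1" := comp1_21 (at level 41, left associativity).
Local Infix "⋆0" := comp0_21 (at level 40, left associativity).

(** Generating 3-cells, whose sources and targets are given by representatives
    of 2-cells of the free (2,1)-category. *)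
Definition generators3 : Type :=
  forall (x y : G) (u v : path x y), cell21 u v -> cell21 u v -> Type.

(** The congruence generated by the axioms of (2,1)-categories and by the
    3-cells of [Gamma]: [cell21] modulo [eq21 Gamma] is the quotient by [Gamma]
    of the free (2,1)-category, which is itself the case of an empty [Gamma]. *)
Inductive eq21 (Gamma : generators3) : forall (x y : G) (u v u' v' : path x y),
    cell21 u v -> cell21 u' v' -> Prop :=
| eq21_gen3 : forall x y (u v : path x y) (f g : cell21 u v),
    Gamma x y u v f g -> eq21 Gamma f g
| eq21_refl : forall x y (u v : path x y) (f : cell21 u v), eq21 Gamma f f
| eq21_sym : forall x y (u v u' v' : path x y)
    (f : cell21 u v) (f' : cell21 u' v'), eq21 Gamma f f' -> eq21 Gamma f' f
| eq21_trans : forall x y (u v u' v' u'' v'' : path x y)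
    (f : cell21 u v) (f' : cell21 u' v') (f'' : cell21 u'' v''),
    eq21 Gamma f f' -> eq21 Gamma f' f'' -> eq21 Gamma f f''
| eq21_inv : forall x y (u v u' v' : path x y)
    (f : cell21 u v) (f' : cell21 u' v'),
    eq21 Gamma f f' -> eq21 Gamma (inv21 f) (inv21 f')
| eq21_comp1 : forall x y (u v w u' v' w' : path x y)
    (f : cell21 u v) (g : cell21 v w) (f' : cell21 u' v') (g' : cell21 v' w'),
    eq21 Gamma f f' -> eq21 Gamma g g' -> eq21 Gamma (f ⋆1 g) (f' ⋆1 g')
| eq21_comp0 : forall x y z (u v u' v' : path x y) (s t s' t' : path y z)
    (f : cell21 u v) (g : cell21 s t) (f' : cell21 u' v') (g' : cell21 s' t'),
    eq21 Gamma f f' -> eq21 Gamma g g' -> eq21 Gamma (f ⋆0 g) (f' ⋆0 g')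
| eq21_comp1_1l : forall x y (u v : path x y) (f : cell21 u v),
    eq21 Gamma (id21 u ⋆1 f) f
| eq21_comp1_1r : forall x y (u v : path x y) (f : cell21 u v),
    eq21 Gamma (f ⋆1 id21 v) f
| eq21_comp1A : forall x y (u v w s : path x y)
    (f : cell21 u v) (g : cell21 v w) (h : cell21 w s),
    eq21 Gamma (f ⋆1 (g ⋆1 h)) ((f ⋆1 g) ⋆1 h)
| eq21_comp1_Vl : forall x y (u v : path x y) (f : cell21 u v),
    eq21 Gamma (inv21 f ⋆1 f) (id21 v)
| eq21_comp1_Vr : forall x y (u v : path x y) (f : cell21 u v),
    eq21 Gamma (f ⋆1 inv21 f) (id21 u)
| eq21_comp0_1l : forall x y (u v : path x y) (f : cell21 u v),
    eq21 Gamma (id21 (path_nil x) ⋆0 f) f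
| eq21_comp0_1r : forall x y (u v : path x y) (f : cell21 u v),
    eq21 Gamma (f ⋆0 id21 (path_nil y)) f
| eq21_comp0A : forall x y z t (u v : path x y) (u' v' : path y z)
    (u'' v'' : path z t)
    (f : cell21 u v) (g : cell21 u' v') (h : cell21 u'' v''),
    eq21 Gamma (f ⋆0 (g ⋆0 h)) ((f ⋆0 g) ⋆0 h)
| eq21_comp0_id : forall x y z (u : path x y) (v : path y z),
    eq21 Gamma (id21 u ⋆0 id21 v) (id21 (cat u v))
| eq21_exchange : forall x y z (u v w : path x y) (u' v' w' : path y z)
    (f : cell21 u v) (g : cell21 v w) (f' : cell21 u' v') (g' : cell21 v' w'),
    eq21 Gamma ((f ⋆1 g) ⋆0 (f' ⋆1 g')) ((f ⋆0 f') ⋆1 (g ⋆0 g')).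

Definition homotopy_basis (Gamma : generators3) : Prop :=
  forall (x y : G) (u v : path x y) (f g : cell21 u v), eq21 Gamma f g.

Fixpoint cell21_of_cell2 (x y : G) (u v : path x y) (f : cell2 Sigma u v) :
    cell21 u v :=
  match f in cell2 _ u v return cell21 u v with
  | gen2 a => gen21 a
  | id2 u => id21 u
  | comp1 f g => cell21_of_cell2 f ⋆1 cell21_of_cell2 g
  | comp0 f g => cell21_of_cell2 f ⋆0 cell21_of_cell2 g
  end.

End FreeTwoOneCategory.

Arguments gen21 {G Sigma x y u v} _.
Arguments id21 {G Sigma x y} u.

Record polygraph31 (G : graph) : Type := Polygraph31 {
  underlying2 :> polygraph2 G;
  gens3 : generators3 underlying2
}.

Definition convergent31 (G : graph) (P : polygraph31 G) : Prop :=
  convergent P.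

Definition coherent_presentation (G : graph) (P : polygraph31 G)
    (C : category) : Prop :=
  presents P C /\ homotopy_basis (@gens3 G P).

(** * Maps induced by maps of generating 2-cells *)

Section Functoriality.
Variable G : graph.

Definition map_gens (Sigma Sigma' : polygraph2 G) : Type :=
  forall (x y : G) (u v : path x y), Sigma x y u v -> Sigma' x y u v.

Variables (Sigma Sigma' : polygraph2 G) (j : map_gens Sigma Sigma').

Fixpoint map_cell2 (x y : G) (u v : path x y) (f : cell2 Sigma u v) :
    cell2 Sigma' u v :=
  match f in cell2 _ u v return cell2 Sigma' u v with
  | gen2 a => gen2 (j a)
  | id2 u => id2 u
  | comp1 f g => comp1 (map_cell2 f) (map_cell2 g)
  | comp0 f g => comp0 (map_cell2 f) (map_cell2 g)
  end.

Fixpoint map_cell21 (x y : G) (u v : path x y) (f : cell21 Sigma u v) :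
    cell21 Sigma' u v :=
  match f in cell21 _ u v return cell21 Sigma' u v with
  | gen21 a => gen21 (j a)
  | id21 u => id21 u
  | inv21 f => inv21 (map_cell21 f)
  | comp1_21 f g => comp1_21 (map_cell21 f) (map_cell21 g)
  | comp0_21 f g => comp0_21 (map_cell21 f) (map_cell21 g)
  end.

Definition map_branching (x y : G) (b : branching Sigma x y) :
    branching Sigma' x y :=
  Branching (map_cell2 (bleft b)) (map_cell2 (bright b)).

End Functoriality.

(** * Homotopical completion *)

Section Completion.
Variables (G : graph) (le : path_relation G).

Section Resolution.
Variable Sigma : polygraph2 G.

(** The choices made when a branching [b] is treated. *)
Inductive resolution (x y : G) (b : branching Sigma x y) : Type :=
| res_confluent (t : path x y)
    (f' : cell2 Sigma (bltgt b) t) (g' : cell2 Sigma (brtgt b) t)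
| res_left_to_right (vh wh : path x y)
    (f' : cell2 Sigma (bltgt b) vh) (g' : cell2 Sigma (brtgt b) wh)
    (_ : ~ confluent_branching b) (_ : normal_form Sigma vh)
    (_ : normal_form Sigma wh) (_ : strict le wh vh)
| res_right_to_left (vh wh : path x y)
    (f' : cell2 Sigma (bltgt b) vh) (g' : cell2 Sigma (brtgt b) wh)
    (_ : ~ confluent_branching b) (_ : normal_form Sigma vh)
    (_ : normal_form Sigma wh) (_ : strict le vh wh).

(** The generating 2-cell added by a resolution, if any. *)
Inductive added2 (x y : G) (b : branching Sigma x y) :
    resolution b -> path x y -> path x y -> Type :=
| added_left_to_right : forall vh wh f' g' nc nv nw l,
    added2 (@res_left_to_right x y b vh wh f' g' nc nv nw l) vh wh
| added_right_to_left : forall vh wh f' g' nc nv nw l,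
    added2 (@res_right_to_left x y b vh wh f' g' nc nv nw l) wh vh.

Section Added3.
Variables (Sigma' : polygraph2 G) (old : map_gens Sigma Sigma').
Variables (x y : G) (b : branching Sigma x y).

Let emb (u v : path x y) (f : cell2 Sigma u v) : cell21 Sigma' u v :=
  cell21_of_cell2 (map_cell2 old f).

Local Infix "⋆1" := comp1_21 (at level 41, left associativity).

(** The generating 3-cell added by a resolution, in a 2-polygraph [Sigma']
    that contains [Sigma] via [old] and the added 2-cell via [new]. *)
Inductive added3 : forall (r : resolution b)
    (new : forall u v : path x y, added2 r u v -> Sigma' u v)
    (u v : path x y), cell21 Sigma' u v -> cell21 Sigma' u v -> Type :=
| added3_confluent : forall t f' g' new,
    @added3 (@res_confluent x y b t f' g') new (bsrc b) t
      (emb (bleft b) ⋆1 emb f')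
      (emb (bright b) ⋆1 emb g')
| added3_left_to_right : forall vh wh f' g' nc nv nw l new,
    @added3 (@res_left_to_right x y b vh wh f' g' nc nv nw l) new (bsrc b) wh
      (emb (bleft b) ⋆1 emb f'
        ⋆1 gen21 (new vh wh (added_left_to_right f' g' nc nv nw l)))
      (emb (bright b) ⋆1 emb g')
| added3_right_to_left : forall vh wh f' g' nc nv nw l new,
    @added3 (@res_right_to_left x y b vh wh f' g' nc nv nw l) new (bsrc b) vh
      (emb (bleft b) ⋆1 emb f')
      (emb (bright b) ⋆1 emb g'
        ⋆1 gen21 (new wh vh (added_right_to_left f' g' nc nv nw l))).

End Added3.
End Resolution.

(** A term of the sequence, with the critical branchings already treated. *)
Record stage : Type := Stage {
  poly :> polygraph31 G;
  treated : forall x y : G, branching poly x y -> Prop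
}.

(** [idx] indexes representatives of the unordered critical branchings still
    to be treated, one for each; all of them are resolved with respect to the
    rewriting rules of the same stage [s]. *)
Record treatment (s : stage) : Type := Treatment {
  idx : G -> G -> Type;
  todo : forall x y, idx x y -> branching s x y;
  todo_critical : forall x y (i : idx x y), critical (todo i);
  todo_untreated : forall x y (i : idx x y), ~ treated (todo i);
  todo_complete : forall x y (b : branching s x y),
    critical b -> ~ treated b -> exists i : idx x y, same_branching (todo i) b;
  todo_inj : forall x y (i i' : idx x y),
    same_branching (todo i) (todo i') -> i = i';
  resolve : forall x y (i : idx x y), resolution (todo i)
}.

Definition new2 (s : stage) (T : treatment s) : polygraph2 G :=
  fun x y u v => {i : idx T x y & added2 (resolve i) u v}.

Definition next2 (s : stage) (T : treatment s) : polygraph2 G :=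
  fun x y u v => (underlying2 s u v + new2 T u v)%type.

Definition next_old (s : stage) (T : treatment s) : map_gens s (next2 T) :=
  fun x y u v a => inl a.

Definition next_new (s : stage) (T : treatment s) (x y : G) (i : idx T x y)
    (u v : path x y) (a : added2 (resolve i) u v) : next2 T u v :=
  inr (existT _ i a).

Definition new3 (s : stage) (T : treatment s) : generators3 (next2 T) :=
  fun x y u v f g =>
    {i : idx T x y & added3 (@next_old s T) (@next_new s T x y i) f g}.

Inductive next3 (s : stage) (T : treatment s) : generators3 (next2 T) :=
| next3_old : forall x y (u v : path x y) (f g : cell21 s u v),
    gens3 f g ->
    next3 (map_cell21 (@next_old s T) f) (map_cell21 (@next_old s T) g)
| next3_new : forall x y (u v : path x y) (f g : cell21 (next2 T) u v),
    new3 f g -> next3 f g.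

(** After [T], all the critical branchings of [s] have been treated. *)
Definition next_treated (s : stage) (T : treatment s)
    (x y : G) (b : branching (next2 T) x y) : Prop :=
  exists c : branching s x y,
    critical c /\ same_branching (map_branching (@next_old s T) c) b.

Definition next (s : stage) (T : treatment s) : stage :=
  @Stage (@Polygraph31 G (next2 T) (@next3 s T)) (@next_treated s T).

(** An infinite sequence of successive treatments, starting from [s]. *)
CoInductive completion_from (s : stage) : Type := Complete {
  first : treatment s;
  rest : completion_from (next first)
}.

Fixpoint after (s : stage) (k : completion_from s) (n : nat) :
    {s' : stage & completion_from s'} :=
  match n with
  | 0 => existT _ s k
  | S n' => existT _ (next (first (projT2 (after k n'))))
                     (rest (projT2 (after k n')))
  end.

Definition stage_at (s : stage) (k : completion_from s) (n : nat) : stage :=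
  projT1 (after k n).

Definition treatment_at (s : stage) (k : completion_from s) (n : nat) :
    treatment (stage_at k n) :=
  first (projT2 (after k n)).

Inductive no_generators3 (Sigma : polygraph2 G) : generators3 Sigma := .

Definition initial_stage (Sigma : polygraph2 G) : stage :=
  @Stage (@Polygraph31 G Sigma (@no_generators3 Sigma)) (fun x y b => False).

(** The data of all the choices made along the completion procedure. *)
Definition homotopical_completion (Sigma : polygraph2 G) : Type :=
  completion_from (initial_stage Sigma).

Section Union.
Variables (Sigma : polygraph2 G) (k : homotopical_completion Sigma).

(** The union of the increasing sequence [stage_at k]: each generator is counted
    once, at the step where it is added. *)
Definition union2 : polygraph2 G :=
  fun x y u v => (Sigma u v + {n : nat & new2 (treatment_at k n) u v})%type.

Fixpoint stage_incl (n : nat) : map_gens (stage_at k n) union2 :=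
  match n return map_gens (stage_at k n) union2 with
  | 0 => fun x y u v a => inl a
  | S n' => fun x y u v a =>
      match a with
      | inl a' => @stage_incl n' x y u v a'
      | inr a' => inr (existT _ n' a')
      end
  end.

Inductive union3 : generators3 union2 :=
| union3_new : forall n x y (u v : path x y)
    (f g : cell21 (next2 (treatment_at k n)) u v),
    new3 f g ->
    union3 (map_cell21 (@stage_incl (S n)) f) (map_cell21 (@stage_incl (S n)) g).

Definition completed : polygraph31 G := @Polygraph31 G union2 union3.

End Union.
End Completion.

(* Main.v *)
(** An overlap of the completed polygraph already occurs at a finite stage,
    where a branching of minimal length below it is critical; that one is treated at
    this stage or was treated before, so every local branching of the completed
    polygraph is confluent up to its 3-cells.  Newman's lemma, run with 3-cells,
    then shows that two positive 2-cells from the same source to normal forms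
    are equal modulo the 3-cells.  Choosing a reduction [h] of [u] and [k] of
    [v] to normal forms, every 2-cell [f : u => v] of the free (2,1)-category
    satisfies [h = f k], hence is determined by [u] and [v]. *)

From Stdlib Require Import Classical Arith Lia FunctionalExtensionality
  PropExtensionality ProofIrrelevance Program.Equality.
Require Import Defs.

Set Implicit Arguments.
Unset Strict Implicit.

(** * Paths *)

Section Paths.
Variable G : graph.

Fixpoint path_length (x y : G) (u : path x y) : nat :=
  match u with
  | path_nil _ => 0
  | path_cons _ u' => S (path_length u')
  end.

Lemma path_length_cat (x y z : G) (u : path x y) (v : path y z) :
  path_length (cat u v) = path_length u + path_length v.
Proof.
  revert z v; induction u as [|x y z' a u IH]; intros; simpl;
    [reflexivity | now rewrite IH].
Qed.

Lemma cat_inj_l (x y z : G) (w : path x y) (u v : path y z) :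
  cat w u = cat w v -> u = v.
Proof.
  revert z u v; induction w as [|x y z' a w IH]; intros z u v; simpl.
  - easy.
  - intros H; dependent destruction H; now apply IH.
Qed.

Lemma cat_inj_r (x y z : G) (u v : path x y) (w : path y z) :
  cat u w = cat v w -> u = v.
Proof.
  revert v w; induction u as [x|x y z' a u IH]; intros v w H.
  (* A nonempty loop [v] with [cat v w = w] is well typed; only its length excludes it. *)
  - assert (L := f_equal (@path_length _ _) H).
    rewrite !path_length_cat in L; simpl in L.
    dependent destruction v; [reflexivity | simpl in L; lia].
  - assert (L := f_equal (@path_length _ _) H).
    rewrite !path_length_cat in L; simpl in L.
    dependent destruction v; [simpl in L; lia |].
    simpl in H; dependent destruction H; f_equal; now apply (IH _ w).
Qed.

End Paths.

(** * Free 2-categories *)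

Section FreeTwoCategoryFacts.
Variables (G : graph) (Sigma : polygraph2 G).

(** The relation is heterogeneous; this recovers from it the equations between endpoints on which
    later substitutions rely. *)
Lemma eq2_boundary (x y : G) (u v u' v' : path x y)
    (f : cell2 Sigma u v) (f' : cell2 Sigma u' v') :
  eq2 f f' -> u = u' /\ v = v'.
Proof.
  induction 1; repeat match goal with H : _ /\ _ |- _ => destruct H end;
    subst; simpl; auto using cat_nil_r, cat_assoc.
Qed.

Lemma eq2_cast_source (x y : G) (u u' v : path x y) (f : cell2 Sigma u v) :
  u = u' -> exists f' : cell2 Sigma u' v, eq2 f' f.
Proof. intros <-; exists f; constructor. Qed.

Lemma whisker_eq2 (x' x y y' : G) (w : path x' x) (u v u' v' : path x y)
    (f : cell2 Sigma u v) (f' : cell2 Sigma u' v') (w' : path y y') :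
  eq2 f f' -> eq2 (whisker w f w') (whisker w f' w').
Proof. intros H; repeat apply eq2_comp0; auto using eq2_refl. Qed.

Lemma whisker_nil (x y : G) (u v : path x y) (f : cell2 Sigma u v) :
  eq2 (whisker (path_nil x) f (path_nil y)) f.
Proof. eapply eq2_trans; [apply eq2_comp0_1r | apply eq2_comp0_1l]. Qed.

Lemma whisker_whisker (x2 x1 x y y1 y2 : G) (w2 : path x2 x1) (w1 : path x1 x)
    (u v : path x y) (f : cell2 Sigma u v)
    (w1' : path y y1) (w2' : path y1 y2) :
  eq2 (whisker w2 (whisker w1 f w1') w2')
      (whisker (cat w2 w1) f (cat w1' w2')).
Proof.
  unfold whisker; apply eq2_sym.
  eapply eq2_trans.
  { apply eq2_comp0; [apply eq2_comp0; [|apply eq2_refl] |];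
      apply eq2_sym, eq2_comp0_id. }
  eapply eq2_trans; [apply eq2_comp0A |].
  apply eq2_comp0; [| apply eq2_refl].
  eapply eq2_trans; [| apply eq2_sym, eq2_comp0A].
  apply eq2_comp0; [| apply eq2_refl].
  apply eq2_sym, eq2_comp0A.
Qed.

(** * Rewriting steps and the first step of a 2-cell *)

Lemma rewriting_step_eq2 (x y : G) (u v u' v' : path x y)
    (f : cell2 Sigma u v) (f' : cell2 Sigma u' v') :
  eq2 f f' -> rewriting_step f -> rewriting_step f'.
Proof.
  intros H (x' & y' & w & s & t & a & w' & E).
  exists x', y', w, s, t, a, w'.
  eapply eq2_trans; [apply eq2_sym |]; eassumption.
Qed.

Lemma rewriting_step_whisker (x' x y y' : G) (w : path x' x) (u v : path x y)
    (f : cell2 Sigma u v) (w' : path y y') :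
  rewriting_step f -> rewriting_step (whisker w f w').
Proof.
  intros (x1 & y1 & z & s & t & a & z' & E).
  exists x1, y1, (cat w z), s, t, a, (cat z' w').
  eapply eq2_trans; [apply whisker_eq2, E | apply whisker_whisker].
Qed.

Lemma rewriting_step_comp0_id (x y z : G) (u v : path x y)
    (f : cell2 Sigma u v) (w : path y z) :
  rewriting_step f -> rewriting_step (comp0 f (id2 w)).
Proof.
  intros H; eapply rewriting_step_eq2;
    [| exact (rewriting_step_whisker (path_nil x) w H)].
  apply eq2_comp0; [apply eq2_comp0_1l | apply eq2_refl].
Qed.

Lemma rewriting_step_id_comp0 (x y z : G) (w : path x y) (u v : path y z)
    (f : cell2 Sigma u v) :
  rewriting_step f -> rewriting_step (comp0 (id2 w) f).
Proof.
  intros H; eapply rewriting_step_eq2;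
    [| exact (rewriting_step_whisker w (path_nil z) H)].
  apply eq2_comp0_1r.
Qed.

Lemma rewriting_step_gen2 (x y : G) (u v : path x y) (a : Sigma u v) :
  rewriting_step (gen2 a).
Proof.
  exists x, y, (path_nil x), u, v, a, (path_nil y); apply eq2_sym, whisker_nil.
Qed.

(** By exchange, a 0-composite can start with the first step of its left factor, whiskered by the
    source of the right one; if the left factor is an identity, the first step of the right one
    serves. Splitting off a single step is what the induction in Newman's lemma consumes. *)
Lemma cell2_decomposition (x y : G) (u v : path x y) (f : cell2 Sigma u v) :
  eq2 f (id2 u) \/
  exists t (s : cell2 Sigma u t) (r : cell2 Sigma t v),
    rewriting_step s /\ eq2 f (comp1 s r).
Proof.
  induction f as [x y u v a | x y u | x y u v w f IHf g IHg
                 | x y z u v u' v' f IHf g IHg].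
  - right; exists v, (gen2 a), (id2 v); split.
    + apply rewriting_step_gen2.
    + apply eq2_sym, eq2_comp1_1r.
  - left; apply eq2_refl.
  - destruct IHf as [E | (t & s & r & Hs & E)].
    + assert (v = u) as -> by apply (eq2_boundary E).
      assert (Eg : eq2 (comp1 f g) g).
      { eapply eq2_trans; [apply eq2_comp1; [exact E | apply eq2_refl] |].
        apply eq2_comp1_1l. }
      destruct IHg as [E' | (t & s & r & Hs & E')].
      * left; eapply eq2_trans; eassumption.
      * right; exists t, s, r; split; [exact Hs |].
        eapply eq2_trans; eassumption.
    + right; exists t, s, (comp1 r g); split; [exact Hs |].
      eapply eq2_trans; [apply eq2_comp1; [exact E | apply eq2_refl] |].
      apply eq2_sym, eq2_comp1A.
  - destruct IHf as [E | (t & s & r & Hs & E)].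
    + assert (v = u) as -> by apply (eq2_boundary E).
      destruct IHg as [E' | (t & s & r & Hs & E')].
      * left; eapply eq2_trans; [apply eq2_comp0; eassumption |].
        apply eq2_comp0_id.
      * right; exists (cat u t), (comp0 (id2 u) s), (comp0 f r); split.
        -- now apply rewriting_step_id_comp0.
        -- eapply eq2_trans; [| apply eq2_exchange].
           apply eq2_comp0; [apply eq2_sym, eq2_comp1_1l | exact E'].
    + right; exists (cat t u'), (comp0 s (id2 u')), (comp0 r g); split.
      * now apply rewriting_step_comp0_id.
      * eapply eq2_trans; [| apply eq2_exchange].
        apply eq2_comp0; [exact E | apply eq2_sym, eq2_comp1_1l].
Qed.

Lemma cell2_congruent (x y : G) (u v : path x y) :
  cell2 Sigma u v -> congruent Sigma u v.
Proof. induction 1; eauto using congruent. Qed.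

(** * Branchings and their order by inclusion of sources *)

Lemma same_branching_sym (x y : G) (b c : branching Sigma x y) :
  same_branching b c -> same_branching c b.
Proof.
  intros [[H H'] | [H H']]; [left | right]; split; now apply eq2_sym.
Qed.

Lemma same_branching_trans (x y : G) (b c d : branching Sigma x y) :
  same_branching b c -> same_branching c d -> same_branching b d.
Proof.
  intros [[] | []] [[] | []]; [left | right | right | left];
    split; eapply eq2_trans; eassumption.
Qed.

Lemma same_branching_whisker (x' x y y' : G) (w : path x' x)
    (b c : branching Sigma x y) (w' : path y y') :
  same_branching b c ->
  same_branching (whisker_branching w b w') (whisker_branching w c w').
Proof. intros [[]|[]]; [left | right]; split; now apply whisker_eq2. Qed.

Lemma same_branching_source (x y : G) (b c : branching Sigma x y) :
  same_branching b c -> bsrc b = bsrc c.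
Proof. now intros [[H _]|[H _]]; apply eq2_boundary in H. Qed.

Lemma branching_le_refl (x y : G) (b : branching Sigma x y) :
  branching_le b b.
Proof.
  exists (path_nil x), (path_nil y); left; split; apply whisker_nil.
Qed.

Lemma branching_le_trans (x y x' y' x2 y2 : G) (b : branching Sigma x y)
    (c : branching Sigma x' y') (d : branching Sigma x2 y2) :
  branching_le b c -> branching_le c d -> branching_le b d.
Proof.
  intros (w & w' & H) (z & z' & H').
  exists (cat z w), (cat w' z').
  eapply same_branching_trans; [| exact H'].
  eapply same_branching_trans; [| apply same_branching_whisker, H].
  left; split; apply eq2_sym, whisker_whisker.
Qed.

(** Whiskering by a context that is not empty lengthens the source, while whiskering by empty
    contexts is reversible. The inclusion order is therefore well-founded up to equivalence. *)
Lemma branching_le_length (x y x' y' : G) (b : branching Sigma x y)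
    (c : branching Sigma x' y') :
  branching_le b c ->
  path_length (bsrc b) < path_length (bsrc c) \/ branching_le c b.
Proof.
  intros (w & w' & H).
  assert (L := f_equal (@path_length _ _ _) (same_branching_source H)).
  simpl in L; rewrite !path_length_cat in L.
  destruct w as [x|? ? ? ? ?]; [| left; simpl in L; lia].
  destruct w' as [y|? ? ? ? ?]; [| left; simpl in L; lia].
  right; exists (path_nil x), (path_nil y).
  eapply same_branching_trans;
    [apply same_branching_whisker, same_branching_sym, H |].
  eapply same_branching_trans
    with (whisker_branching (path_nil x) b (path_nil y));
    left; split; apply whisker_nil.
Qed.

(** Strong induction on the length of the source: an overlap that is not critical lies strictly
    above another overlap, which then has a shorter source. *)
Lemma overlap_above_critical (x y : G) (b : branching Sigma x y) :
  overlap b ->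
  exists (x' y' : G) (c : branching Sigma x' y'),
    critical c /\ branching_le c b.
Proof.
  remember (path_length (bsrc b)) as n eqn:En.
  revert x y b En; induction n as [n IH] using lt_wf_ind; intros x y b -> Hb.
  destruct (classic (critical b)) as [Hc | Hc].
  { exists x, y, b; split; [exact Hc | apply branching_le_refl]. }
  assert (exists x' y' (c : branching Sigma x' y'),
    overlap c /\ branching_le c b /\ ~ branching_le b c)
    as (x' & y' & c & Oc & Hcb & Nbc).
  { apply NNPP; intros N; apply Hc; split; [exact Hb |].
    intros x' y' c Oc Hcb; apply NNPP; intros Nbc; apply N.
    now exists x', y', c. }
  destruct (branching_le_length Hcb) as [L | L]; [| contradiction].
  destruct (IH _ L _ _ c eq_refl Oc) as (x2 & y2 & d & Hd & Hdc).
  exists x2, y2, d; split; [exact Hd |].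
  eapply branching_le_trans; eassumption.
Qed.

Lemma local_branching_cases (x y : G) (b : branching Sigma x y) :
  local_branching b ->
  aspherical b \/ peiffer b \/
  exists (x' y' : G) (c : branching Sigma x' y'),
    critical c /\ branching_le c b.
Proof.
  intros Hb.
  destruct (classic (aspherical b)); [now left |].
  destruct (classic (peiffer b)); [now right; left |].
  right; right; now apply overlap_above_critical.
Qed.

End FreeTwoCategoryFacts.

(** * Functoriality in the generating 2-cells *)

Section Maps.
Variables (G : graph) (Sigma Sigma' : polygraph2 G) (j : map_gens Sigma Sigma').

Lemma map_cell2_eq2 (x y : G) (u v u' v' : path x y)
    (f : cell2 Sigma u v) (f' : cell2 Sigma u' v') :
  eq2 f f' -> eq2 (map_cell2 j f) (map_cell2 j f').
Proof.
  induction 1; simpl; try (now constructor); eauto using eq2_sym, eq2_trans.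
Qed.

Lemma map_cell2_comp (Sigma'' : polygraph2 G) (j' : map_gens Sigma' Sigma'')
    (x y : G) (u v : path x y) (f : cell2 Sigma u v) :
  map_cell2 j' (map_cell2 j f) =
  map_cell2 (fun x y u v a => j' x y u v (j a)) f.
Proof. induction f; simpl; congruence. Qed.

Lemma map_cell21_of_cell2 (x y : G) (u v : path x y) (f : cell2 Sigma u v) :
  map_cell21 j (cell21_of_cell2 f) = cell21_of_cell2 (map_cell2 j f).
Proof. induction f; simpl; congruence. Qed.

Lemma map_branching_same (x y : G) (b c : branching Sigma x y) :
  same_branching b c ->
  same_branching (map_branching j b) (map_branching j c).
Proof. intros [[]|[]]; [left | right]; split; now apply map_cell2_eq2. Qed.

End Maps.

(** * Comparison of presented categories *)

Lemma congruent_mono (G : graph) (Sigma Sigma' : polygraph2 G) :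
  (forall (x y : G) (u v : path x y), Sigma x y u v -> congruent Sigma' u v) ->
  forall (x y : G) (u v : path x y),
    congruent Sigma u v -> congruent Sigma' u v.
Proof. intros H x y u v; induction 1; eauto using congruent. Qed.

(** Extensionality identifies the two congruences, and the proofs they carry are irrelevant. Having
    an equality rather than an isomorphism lets presentations transfer by rewriting. *)
Lemma presented_category_eq (G : graph) (Sigma Sigma' : polygraph2 G) :
  (forall (x y : G) (u v : path x y),
     congruent Sigma u v <-> congruent Sigma' u v) ->
  presented_category Sigma = presented_category Sigma'.
Proof.
  intros H; unfold presented_category; f_equal.
  unfold generated_congruence.
  assert (E : @congruent G Sigma = @congruent G Sigma').
  { do 4 (apply functional_extensionality_dep; intros ?).
    apply propositional_extensionality, H. }
  (* The proofs in the record depend on the relation, so they are generalized before [E] rewrites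
     it. *)
  generalize (@congruent_refl G Sigma) (@congruent_sym G Sigma)
    (@congruent_trans G Sigma) (@congruent_cat G Sigma).
  rewrite E; intros; f_equal; apply proof_irrelevance.
Qed.

(** * Termination orders *)

Section Decreasing.
Variables (G : graph) (Sigma Sigma' : polygraph2 G) (le : path_relation G).
Hypothesis order : termination_order Sigma le.

(** Compatibility of [le] with concatenation is only weak; strictness survives because concatenation
    is cancellative. *)
Lemma strict_whisker (x' x y y' : G) (w : path x' x) (u v : path x y)
    (w' : path y y') :
  strict le u v -> strict le (cat (cat w u) w') (cat (cat w v) w').
Proof.
  intros [L N]; split.
  - repeat apply (le_cat order); try apply (le_refl order); exact L.
  - intros E; apply N; now apply cat_inj_r, cat_inj_l in E.
Qed.

(** Only the last axiom of a termination order mentions the 2-cells, and a rewriting step is a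
    single generator in a context. *)
Lemma termination_order_of_decreasing :
  (forall (x y : G) (u v : path x y), Sigma' u v -> strict le v u) ->
  termination_order Sigma' le.
Proof.
  intros H; destruct order; constructor; auto.
  intros x y u v f (x' & y' & w & s & t & a & w' & E).
  destruct (eq2_boundary E) as [-> ->].
  now apply strict_whisker, H.
Qed.

Lemma termination_order_terminating : terminating Sigma.
Proof.
  intros (x & y & u & f & Hf).
  (* Well-founded induction on the value [v], for all indices at once: the step leaving [u n] makes
     the value at [S n] smaller. *)
  assert (N : forall v : path x y, forall n, u n <> v).
  { intros v.
    induction v as [v IH] using (well_founded_ind (lt_wf order (y := y))).
    intros n <-; exact (IH _ (lt_step order (Hf n)) (S n) eq_refl). }
  exact (N _ 0 eq_refl).
Qed.

End Decreasing.

(** * Coherence from coherent local confluence *)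

Section Coherence.
Variables (G : graph) (P : polygraph31 G).

Local Notation "f ≡ g" := (eq21 (@gens3 G P) f g) (at level 70).
Local Notation pos := (@cell21_of_cell2 G P _ _ _ _).

Lemma eq21_boundary (x y : G) (u v u' v' : path x y)
    (f : cell21 P u v) (f' : cell21 P u' v') :
  f ≡ f' -> u = u' /\ v = v'.
Proof.
  induction 1; repeat match goal with H : _ /\ _ |- _ => destruct H end;
    subst; simpl; auto using cat_nil_r, cat_assoc.
Qed.

Lemma eq21_of_eq2 (x y : G) (u v u' v' : path x y)
    (f : cell2 P u v) (f' : cell2 P u' v') :
  eq2 f f' -> pos f ≡ pos f'.
Proof.
  induction 1; simpl; try (now constructor); eauto using eq21_sym, eq21_trans.
Qed.

Definition coherently_confluent (x y : G) (b : branching P x y) : Prop :=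
  exists (t : path x y) (f' : cell2 P (bltgt b) t) (g' : cell2 P (brtgt b) t),
    pos (comp1 (bleft b) f') ≡ pos (comp1 (bright b) g').

Lemma coherently_confluent_same (x y : G) (b c : branching P x y) :
  same_branching b c -> coherently_confluent b -> coherently_confluent c.
Proof.
  destruct b as [u v w f g], c as [u' v' w' f2 g2].
  intros [[H H']|[H H']] (t & h & k & E); simpl in *;
    destruct (eq2_boundary H) as [-> ->]; destruct (eq2_boundary H') as [_ ->];
    apply eq21_of_eq2 in H, H'.
  - exists t, h, k; simpl.
    eapply eq21_trans;
      [apply eq21_comp1; [apply eq21_sym, H | apply eq21_refl] |].
    eapply eq21_trans; [exact E |].
    apply eq21_comp1; [exact H' | apply eq21_refl].
  - exists t, k, h; simpl.
    eapply eq21_trans;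
      [apply eq21_comp1; [apply eq21_sym, H' | apply eq21_refl] |].
    eapply eq21_trans; [apply eq21_sym, E |].
    apply eq21_comp1; [exact H | apply eq21_refl].
Qed.

Lemma whisker_comp1 (x' x y y' : G) (z : path x' x) (u v w : path x y)
    (f : cell2 P u v) (g : cell2 P v w) (z' : path y y') :
  eq2 (comp1 (whisker z f z') (whisker z g z')) (whisker z (comp1 f g) z').
Proof.
  unfold whisker; apply eq2_sym.
  eapply eq2_trans; [| apply eq2_exchange].
  apply eq2_comp0; [| apply eq2_sym, eq2_comp1_1l].
  eapply eq2_trans; [| apply eq2_exchange].
  apply eq2_comp0; [apply eq2_sym, eq2_comp1_1l | apply eq2_refl].
Qed.

(** Whiskering commutes with vertical composition and respects [≡], so a filled diagram stays filled
    in any context. *)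
Lemma coherently_confluent_whisker (x' x y y' : G) (z : path x' x)
    (b : branching P x y) (z' : path y y') :
  coherently_confluent b -> coherently_confluent (whisker_branching z b z').
Proof.
  intros (t & h & k & E).
  exists (cat (cat z t) z'), (whisker z h z'), (whisker z k z').
  eapply eq21_trans; [apply eq21_of_eq2, whisker_comp1 |].
  eapply eq21_trans; [| apply eq21_sym, eq21_of_eq2, whisker_comp1].
  unfold whisker; cbn [cell21_of_cell2].
  repeat apply eq21_comp0; auto using eq21_refl.
Qed.

Lemma aspherical_coherently_confluent (x y : G) (b : branching P x y) :
  aspherical b -> coherently_confluent b.
Proof.
  destruct b as [u v w f g]; unfold aspherical; simpl; intros H.
  destruct (eq2_boundary H) as [_ <-].
  exists v, (id2 v), (id2 v); simpl.
  apply eq21_comp1; [now apply eq21_of_eq2 | apply eq21_refl].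
Qed.

(** Exchange alone closes the square: both ways round equal [comp0 f g]. *)
Lemma peiffer_coherently_confluent (x y z : G) (u u' : path x y)
    (v v' : path y z) (f : cell2 P u u') (g : cell2 P v v') :
  coherently_confluent (Branching (comp0 f (id2 v)) (comp0 (id2 u) g)).
Proof.
  exists (cat u' v'), (comp0 (id2 u') g), (comp0 f (id2 v')).
  apply eq21_of_eq2; simpl.
  eapply eq2_trans; [apply eq2_sym, eq2_exchange |].
  eapply eq2_trans; [| apply eq2_exchange].
  apply eq2_comp0.
  - eapply eq2_trans; [apply eq2_comp1_1r | apply eq2_sym, eq2_comp1_1l].
  - eapply eq2_trans; [apply eq2_comp1_1l | apply eq2_sym, eq2_comp1_1r].
Qed.

Variable le : path_relation G.
Hypothesis order : termination_order P le.

Lemma normalization (x y : G) (u : path x y) :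
  exists (n : path x y) (f : cell2 P u n), normal_form P n.
Proof.
  induction u as [u IH] using (well_founded_ind (lt_wf order (y := y))).
  destruct (classic (normal_form P u)) as [N | N].
  { now exists u, (id2 u). }
  apply NNPP in N as (v & f & Hf).
  destruct (IH v (lt_step order Hf)) as (n & g & Hn).
  now exists n, (comp1 f g).
Qed.

Hypothesis local_confluence : forall (x y : G) (b : branching P x y),
  local_branching b -> coherently_confluent b.

(* Newman's lemma, with the confluence diagrams filled by 3-cells; equality of
   the two normal forms is part of [≡]. *)
Lemma eq21_to_normal_forms (x y : G) (u v w : path x y)
    (f : cell2 P u v) (g : cell2 P u w) :
  normal_form P v -> normal_form P w -> pos f ≡ pos g.
Proof.
  revert v w f g.
  induction u as [u IH] using (well_founded_ind (lt_wf order (y := y))).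
  intros v w f g Nv Nw.
  destruct (cell2_decomposition f) as [Ef | (v1 & s & r & Hs & Ef)],
    (cell2_decomposition g) as [Eg | (w1 & s' & r' & Hs' & Eg)].
  - apply eq21_of_eq2; eapply eq2_trans; [exact Ef | apply eq2_sym, Eg].
  (* Here [f] is an identity, so [s'] would be a step out of the normal form [v]. *)
  - destruct (eq2_boundary Ef) as [_ ->]; exfalso; apply Nv; eauto.
  - destruct (eq2_boundary Eg) as [_ ->]; exfalso; apply Nw; eauto.
  - destruct (@local_confluence _ _ (Branching s s')) as (t & h & k & E);
      [now split | simpl in h, k, E].
    destruct (normalization t) as (n & e & Nn).
    (* Both [v1] and [w1] are below [u]; the induction hypothesis compares [r] and [r'] with the two
       closing sides of the filled square, each followed by the reduction [e] of its corner [t]. *)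
    assert (E1 : pos r ≡ pos (comp1 h e))
      by exact (IH _ (lt_step order Hs) _ _ _ _ Nv Nn).
    assert (E2 : pos r' ≡ pos (comp1 k e))
      by exact (IH _ (lt_step order Hs') _ _ _ _ Nw Nn).
    eapply eq21_trans; [apply eq21_of_eq2, Ef |].
    eapply eq21_trans; [| apply eq21_sym, eq21_of_eq2, Eg].
    simpl in *.
    eapply eq21_trans; [apply eq21_comp1; [apply eq21_refl | exact E1] |].
    eapply eq21_trans;
      [| apply eq21_sym, eq21_comp1; [apply eq21_refl | exact E2]].
    eapply eq21_trans; [apply eq21_comp1A |].
    eapply eq21_trans; [| apply eq21_sym, eq21_comp1A].
    apply eq21_comp1; [exact E | apply eq21_refl].
Qed.

(** Reduce both targets to normal forms: [≡] relates only cells with equal targets, so the two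
    normal forms coincide. *)
Lemma confluent_of_local : confluent P.
Proof.
  intros x y [u v w f g].
  destruct (normalization v) as (v1 & h & Nv).
  destruct (normalization w) as (w1 & k & Nw).
  destruct (eq21_boundary (eq21_to_normal_forms (comp1 f h) (comp1 g k) Nv Nw))
    as [_ <-].
  now exists v1, h, k.
Qed.

Lemma eq21_cancel_r (x y : G) (u v w : path x y) (f f' : cell21 P u v)
    (g : cell21 P v w) :
  comp1_21 f g ≡ comp1_21 f' g -> f ≡ f'.
Proof.
  assert (R : forall h : cell21 P u v, comp1_21 (comp1_21 h g) (inv21 g) ≡ h).
  { intros h; eapply eq21_trans; [apply eq21_sym, eq21_comp1A |].
    eapply eq21_trans; [| apply eq21_comp1_1r].
    apply eq21_comp1; [apply eq21_refl | apply eq21_comp1_Vr]. }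
  intros H; eapply eq21_trans; [apply eq21_sym, R |].
  eapply eq21_trans; [| apply R].
  apply eq21_comp1; [exact H | apply eq21_refl].
Qed.

(* For a 0-composite, the induction hypotheses apply after first reducing the
   two factors separately. *)
Lemma eq21_normalize (x y : G) (u v : path x y) (f : cell21 P u v) :
  forall (n m : path x y) (h : cell2 P u n) (k : cell2 P v m),
    normal_form P n -> normal_form P m -> pos h ≡ comp1_21 f (pos k).
Proof.
  induction f as [x y u v a | x y u | x y u v f IH
                 | x y u v w f IHf g IHg | x y z u v u' v' f IHf g IHg];
    intros n m h k Nn Nm.
  (* The generator followed by [k] is again a positive 2-cell to a normal form. *)
  - exact (eq21_to_normal_forms h (comp1 (gen2 a) k) Nn Nm).
  - eapply eq21_trans; [| apply eq21_sym, eq21_comp1_1l].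
    now apply eq21_to_normal_forms.
  (* The inverse case is the hypothesis for [f] with [h] and [k] exchanged, composed on the left
     with the inverse of [f]. *)
  - eapply eq21_trans; [apply eq21_sym, eq21_comp1_1l |].
    eapply eq21_trans;
      [apply eq21_comp1; [apply eq21_sym, eq21_comp1_Vl | apply eq21_refl] |].
    eapply eq21_trans; [apply eq21_sym, eq21_comp1A |].
    apply eq21_comp1; [apply eq21_refl |].
    apply eq21_sym; now apply IH.
  - destruct (normalization v) as (p & e & Np).
    eapply eq21_trans; [apply (IHf _ _ h e Nn Np) |].
    eapply eq21_trans;
      [apply eq21_comp1; [apply eq21_refl | apply (IHg _ _ e k Np Nm)] |].
    apply eq21_comp1A.
  - destruct (normalization u) as (nu & eu & Nu).
    destruct (normalization u') as (nu' & eu' & Nu').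
    destruct (normalization v) as (nv & ev & Nv).
    destruct (normalization v') as (nv' & ev' & Nv').
    assert (E := IHf _ _ eu ev Nu Nv); assert (E' := IHg _ _ eu' ev' Nu' Nv').
    (* The two ends of each factor share a normal form. The composite [cat nu nu'] may still be
       reducible, hence the further reduction [e]. *)
    destruct (eq21_boundary E) as [_ <-]; destruct (eq21_boundary E') as [_ <-].
    destruct (normalization (cat nu nu')) as (p & e & Np).
    eapply eq21_trans;
      [apply (eq21_to_normal_forms h (comp1 (comp0 eu eu') e) Nn Np) |].
    eapply eq21_trans;
      [| apply eq21_comp1; [apply eq21_refl |
         apply (eq21_to_normal_forms (comp1 (comp0 ev ev') e) k Np Nm)]].
    simpl.
    eapply eq21_trans; [| apply eq21_sym, eq21_comp1A].
    apply eq21_comp1; [| apply eq21_refl].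
    eapply eq21_trans; [| apply eq21_exchange].
    now apply eq21_comp0.
Qed.

Lemma homotopy_basis_of_local : homotopy_basis (@gens3 G P).
Proof.
  intros x y u v f g.
  destruct (normalization u) as (n & h & Nn).
  destruct (normalization v) as (m & k & Nm).
  apply eq21_cancel_r with (g := pos k).
  eapply eq21_trans; [apply eq21_sym |]; now apply eq21_normalize with (h := h).
Qed.

End Coherence.

(** * Resolutions of branchings *)

Section Resolutions.
Variables (G : graph) (le : path_relation G) (Sigma : polygraph2 G).
Variables (x y : G) (b : branching Sigma x y) (r : resolution le b).

Lemma added2_decreasing (u v : path x y) : added2 r u v -> strict le v u.
Proof. now destruct 1. Qed.

(** Both ends of the added 2-cell are reached from the source of [b], so they were already
    identified in the presented category. *)
Lemma added2_congruent (u v : path x y) : added2 r u v -> congruent Sigma u v.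
Proof.
  assert (L := cell2_congruent (bleft b)).
  assert (R := cell2_congruent (bright b)).
  destruct 1; eauto 8 using congruent, cell2_congruent.
Qed.

(** The target [P] is any polygraph in which the image of the added 3-cell becomes an equation, so
    the union can be taken directly. An added 2-cell is absorbed into the closing cell on the
    greater side, which forces the reassociations. *)
Lemma added3_coherently_confluent (Sigma' : polygraph2 G)
    (old : map_gens Sigma Sigma')
    (new : forall u v : path x y, added2 r u v -> Sigma' x y u v)
    (P : polygraph31 G) (j : map_gens Sigma' P) :
  (forall (u v : path x y) (f g : cell21 Sigma' u v),
     added3 old new f g ->
     eq21 (@gens3 G P) (map_cell21 j f) (map_cell21 j g)) ->
  coherently_confluent (map_branching j (map_branching old b)).
Proof.
  intros H; destruct r as
    [t f' g' | vh wh f' g' nc nv nw l | vh wh f' g' nc nv nw l].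
  - exists t, (map_cell2 j (map_cell2 old f')),
      (map_cell2 j (map_cell2 old g')).
    assert (E := H _ _ _ _ (added3_confluent old new)).
    cbn in *; now rewrite !map_cell21_of_cell2 in E.
  - exists wh, (comp1 (map_cell2 j (map_cell2 old f'))
        (gen2 (j _ _ _ _ (new _ _ (added_left_to_right f' g' nc nv nw l))))),
      (map_cell2 j (map_cell2 old g')).
    assert (E := H _ _ _ _ (added3_left_to_right old new)).
    cbn in *; rewrite !map_cell21_of_cell2 in E.
    eapply eq21_trans; [apply eq21_comp1A | exact E].
  - exists vh, (map_cell2 j (map_cell2 old f')),
      (comp1 (map_cell2 j (map_cell2 old g'))
        (gen2 (j _ _ _ _ (new _ _ (added_right_to_left f' g' nc nv nw l))))).
    assert (E := H _ _ _ _ (added3_right_to_left old new)).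
    cbn in *; rewrite !map_cell21_of_cell2 in E.
    eapply eq21_trans; [exact E | apply eq21_sym, eq21_comp1A].
Qed.

End Resolutions.

(** * The completed polygraph *)

Section CompletedPolygraph.
Variables (G : graph) (le : path_relation G) (Sigma : polygraph2 G).
Variable K : homotopical_completion le Sigma.

Lemma stage_congruent (n : nat) (x y : G) (u v : path x y) :
  underlying2 (stage_at K n) u v -> congruent Sigma u v.
Proof.
  revert x y u v; induction n as [|n IH]; intros x y u v.
  - apply congruent_gen.
  - intros [a | [i a]]; [now apply IH |].
    apply (congruent_mono IH), (added2_congruent a).
Qed.

Lemma completed_congruent (x y : G) (u v : path x y) :
  congruent Sigma u v <-> congruent (completed K) u v.
Proof.
  split.
  - apply congruent_mono; clear x y u v; intros x y u v a.
    apply congruent_gen; now left.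
  - apply congruent_mono; clear x y u v; intros x y u v [a | [n a]].
    + now apply congruent_gen.
    (* A 2-cell added by treatment [n] belongs to stage [S n]. *)
    + apply (stage_congruent (n := S n)); now right.
Qed.

Lemma completed_termination_order :
  termination_order Sigma le -> termination_order (completed K) le.
Proof.
  intros order; apply (termination_order_of_decreasing order).
  intros x y u v [a | [n [i a]]].
  - apply (lt_step order (rewriting_step_gen2 a)).
  - apply (added2_decreasing a).
Qed.

(** * Critical branchings of the finite stages *)

Lemma todo_coherently_confluent (n : nat) (x y : G)
    (i : idx (treatment_at K n) x y) :
  @coherently_confluent G (completed K) x y
    (map_branching (stage_incl (n := n)) (todo i)).
Proof.
  assert (E := @added3_coherently_confluent G le _ x y _ (resolve i) _
    (@next_old G le _ (treatment_at K n))
    (@next_new G le _ (treatment_at K n) x y i) (completed K)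
    (@stage_incl G le Sigma K (S n))).
  unfold map_branching in *; simpl in E; rewrite !map_cell2_comp in E.
  apply E; intros u v f g a.
  apply eq21_gen3, (union3_new (k := K) (n := n)).
  now exists i.
Qed.

(** Induction on the stage: an untreated critical branching is indexed by the current treatment, and
    one already treated at stage [S n] is the image of a critical branching of stage [n]. Nothing is
    treated at stage 0. *)
Lemma critical_resolved (n : nat) (x y : G) (b : branching (stage_at K n) x y) :
  critical b ->
  exists (m : nat) (i : idx (treatment_at K m) x y),
    same_branching (map_branching (stage_incl (n := m)) (todo i))
                   (map_branching (stage_incl (n := n)) b).
Proof.
  revert x y b; induction n as [|n IH]; intros x y b Hb.
  all: destruct (classic (treated b)) as [T | T];
    [| destruct (todo_complete (treatment_at K _) Hb T) as [i Hi];
       exists _, i; now apply map_branching_same].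
  - destruct T.
  - destruct T as (c & Hc & E).
    destruct (IH _ _ c Hc) as (m & i & Ei).
    exists m, i; eapply same_branching_trans; [exact Ei |].
    apply (map_branching_same (@stage_incl G le Sigma K (S n))) in E.
    unfold map_branching in E; simpl in E; rewrite !map_cell2_comp in E.
    exact E.
Qed.

(** A generator persists in every stage after the one that introduces it. Asking for all later
    stages allows two generators to be lifted to a common one. *)
Lemma gen2_from_stage (x y : G) (u v : path x y)
    (a : underlying2 (completed K) u v) :
  exists n, forall m, n <= m ->
    exists a' : underlying2 (stage_at K m) u v, stage_incl a' = a.
Proof.
  assert (S1 : forall m (a' : underlying2 (stage_at K m) u v),
    exists a'' : underlying2 (stage_at K (S m)) u v,
      stage_incl a'' = stage_incl a').
  { intros m a'; now exists (inl a'). }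
  assert (S2 : forall n (a' : underlying2 (stage_at K n) u v) m, n <= m ->
    exists a'' : underlying2 (stage_at K m) u v,
      stage_incl a'' = stage_incl a').
  { intros n a' m L; induction L as [|m L (a1 & E1)]; [now exists a' |].
    rewrite <- E1; apply S1. }
  destruct a as [a | [n a]].
  - exists 0; exact (S2 0 a).
  - exists (S n); exact (S2 (S n) (inr a)).
Qed.

(** A rewriting step involves a single generator, so lifting that generator lifts the step. *)
Lemma rewriting_step_from_stage (x y : G) (u v : path x y)
    (f : cell2 (completed K) u v) :
  rewriting_step f ->
  exists n, forall m, n <= m -> exists f' : cell2 (stage_at K m) u v,
    rewriting_step f' /\ eq2 (map_cell2 (stage_incl (n := m)) f') f.
Proof.
  intros (x' & y' & w & s & t & a & w' & E).
  destruct (gen2_from_stage a) as [n Hn]; exists n; intros m L.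
  destruct (Hn m L) as [a' <-].
  destruct (eq2_boundary E) as [-> ->].
  exists (whisker w (gen2 a') w'); split.
  - exists x', y', w, s, t, a', w'; apply eq2_refl.
  - apply eq2_sym, E.
Qed.

Lemma completed_local_confluence (x y : G) (b : branching (completed K) x y) :
  local_branching b -> coherently_confluent b.
Proof.
  destruct b as [u v w f g]; intros [Hf Hg]; simpl in Hf, Hg.
  destruct (rewriting_step_from_stage Hf) as [n Hn].
  destruct (rewriting_step_from_stage Hg) as [n' Hn'].
  destruct (Hn (n + n')) as (f' & Sf & Ef); [lia |].
  destruct (Hn' (n + n')) as (g' & Sg & Eg); [lia |].
  set (b' := Branching f' g').
  assert (E : same_branching (map_branching (stage_incl (n := n + n')) b')
                (Branching f g)) by (now left).
  apply (coherently_confluent_same (P := completed K) E); clear E.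
  (* The case analysis takes place at the finite stage, because [critical_resolved] concerns
     critical branchings of stages; each case is then carried into the union. *)
  destruct (@local_branching_cases G _ x y b')
    as [A | [(z & p & p' & q & q' & h & k & Hh & Hk & E)
            | (x' & y' & c & Hc & z & z' & E)]]; [now split | ..].
  - now apply (aspherical_coherently_confluent (P := completed K)),
      map_cell2_eq2.
  - apply (map_branching_same (stage_incl (n := n + n'))) in E.
    eapply (coherently_confluent_same (P := completed K));
      [apply same_branching_sym, E |].
    apply (peiffer_coherently_confluent (P := completed K)).
  - apply (map_branching_same (stage_incl (n := n + n'))) in E.
    apply (coherently_confluent_same (P := completed K) E).
    apply (coherently_confluent_whisker (P := completed K) z
      (b := map_branching (stage_incl (n := n + n')) c) z').
    destruct (critical_resolved Hc) as (m & i & Ei).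
    apply (coherently_confluent_same (P := completed K) Ei),
      todo_coherently_confluent.
Qed.

End CompletedPolygraph.

Theorem theorem2p2p5 (G : graph) (Sigma : polygraph2 G) (C : category)
    (le : path_relation G) (K : homotopical_completion le Sigma) :
  terminating Sigma ->
  presents Sigma C ->
  termination_order Sigma le ->
  total_order le ->
  coherent_presentation (completed K) C /\ convergent31 (completed K).
Proof.
  intros _ HC order _.
  (* Every added 2-cell decreases for [le], so the original order also orients the completed
     polygraph. *)
  apply (completed_termination_order K) in order.
  assert (local := @completed_local_confluence G le Sigma K).
  split; split.
  (* The completion presents the same category on the nose, so the isomorphism with [C] is
     reused. *)
  - unfold presents.
    now rewrite <- (presented_category_eq (completed_congruent K)).
  - exact (homotopy_basis_of_local order local).
  - exact (termination_order_terminating order).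
  - exact (confluent_of_local order local).
Qed.
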